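(* For any tetrahedron $T$ in $\mathbb{R}^3$, $$\mathrm{Rad}(T)\leq\mathrm{diam}(T),$$ with equality if and only if $T$ is regular.
   Context: A tetrahedron is identified with its surface, a convex polyhedral surface in $\mathbb{R}^3$. For a convex surface $S\subset\mathbb{R}^3$, the intrinsic metric $\rho(x,y)$ is the length of a shortest path on $S$ joining $x,y\in S$. The intrinsic radius is $\mathrm{Rad}(S)=\min_{x\in S}\max_{y\in S}\rho(x,y)$ and the extrinsic diameter is $\mathrm{diam}(S)=\max_{x,y\in S}\|x-y\|$, with $\|\cdot\|$ the Euclidean norm. *)

(* Defs.v *)
From HB Require Import structures.
From mathcomp Require Import all_boot all_order all_algebra.
From mathcomp Require Import all_classical all_reals all_analysis.

Set Implicit Arguments.
Unset Strict Implicit.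
Unset Printing Implicit Defensive.

Import Order.TTheory GRing.Theory Num.Theory numFieldNormedType.Exports.

Local Open Scope classical_set_scope.
Local Open Scope ring_scope.

(* The library's norm `|u| on row vectors is the sup norm, hence a separate
   Euclidean norm; both induce the same topology. *)
Definition enorm (R : realType) (n : nat) (u : 'rV[R]_n) : R :=
  Num.sqrt (\sum_(i < n) u ord0 i ^+ 2).

Definition chord_length (R : realType) (n : nat) (g : R -> 'rV[R]_n)
    (a b : R) (s : seq R) : R :=
  \sum_(0 <= k < size s)
    enorm (g (nth b (a :: s) k.+1) - g (nth b (a :: s) k)).

(* Possibly infinite, as for the library's [total_variation] *)
Definition curve_length (R : realType) (n : nat) (a b : R)
    (g : R -> 'rV[R]_n) : \bar R :=
  ereal_sup [set (chord_length g a b s)%:E | s in itv_partition a b].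

Definition path_on (R : realType) (n : nat) (S : set 'rV[R]_n)
    (x y : 'rV[R]_n) (g : R -> 'rV[R]_n) : Prop :=
  [/\ {within `[0, 1], continuous g},
      (forall t, t \in `[0, 1] -> S (g t)), g 0 = x & g 1 = y].

(* For a compact convex surface, the infima and suprema below are attained
   (shortest paths exist, and S is compact), so they are the minima and maxima
   of the usual definitions. *)
Definition intrinsic_dist (R : realType) (n : nat) (S : set 'rV[R]_n)
    (x y : 'rV[R]_n) : \bar R :=
  ereal_inf [set curve_length 0 1 g | g in path_on S x y].

Definition Rad (R : realType) (n : nat) (S : set 'rV[R]_n) : \bar R :=
  ereal_inf [set ereal_sup [set intrinsic_dist S x y | y in S] | x in S].

Definition diam (R : realType) (n : nat) (S : set 'rV[R]_n) : \bar R :=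
  ereal_sup [set (enorm (x - y))%:E | x in S & y in S].

Definition affine_independent (R : realType) (v : 'I_4 -> 'rV[R]_3) : Prop :=
  row_free (\matrix_(i < 3) (v (lift ord0 i) - v ord0)).

(* The face opposite to v i: convex combinations of the other vertices *)
Definition face (R : realType) (v : 'I_4 -> 'rV[R]_3) (i : 'I_4)
    : set 'rV[R]_3 :=
  [set \sum_(j < 4) w j *: v j | w in
    [set w : 'I_4 -> R |
      [/\ forall j, 0 <= w j, \sum_(j < 4) w j = 1 & w i = 0]]].

Definition tetrahedron (R : realType) (v : 'I_4 -> 'rV[R]_3)
    : set 'rV[R]_3 :=
  \bigcup_i face v i.

Definition regular_tetrahedron (R : realType) (v : 'I_4 -> 'rV[R]_3) : Prop :=
  forall i j k l : 'I_4, i != j -> k != l ->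
    enorm (v i - v j) = enorm (v k - v l).

(* Main.v *)
(* Let AB be a longest edge, of length l, M its midpoint and N the midpoint of
   CD. The path from M to N through the midpoint of AC has length
   (BC + AD) / 2 <= l, and likewise through the midpoints of AD, BC and BD. The
   length of a two-legged path through an edge is convex, so every point of the
   face ACD, split along AN, is within l of M; the same holds for BCD, and the
   faces ABC and ABD are within l sqrt 3 / 2 of M. When some edge is shorter
   than l, moving N along CD and the crossing points along the edges makes all
   these bounds strict, hence Rad < l.

   For a regular tetrahedron, unfold the surface into the triangular lattice;
   the tetrahedron is the quotient of the plane by the half-turns about lattice
   points. For x = a A + b B + c C with c <= a <= b an explicit point y of ACD
   has all points of its orbit at distance >= l from x. A curve on the surface
   is compared with its unfolding through the chain of chords cut at the last
   times it visits each face. *)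
Require Import Defs.
From mathcomp Require Import all_boot all_order all_algebra.
From mathcomp Require Import all_classical all_reals all_analysis.
From mathcomp Require Import ring lra zify.

Set Implicit Arguments.
Unset Strict Implicit.
Unset Printing Implicit Defensive.

Import Order.TTheory GRing.Theory Num.Theory numFieldNormedType.Exports.

Local Open Scope classical_set_scope.
Local Open Scope ring_scope.

(** * Euclidean norm *)

Section Euclidean.
Variables (R : realType) (n : nat).
Implicit Types (u v w A B C D : 'rV[R]_n) (a b c d k : R).

Lemma sqr_enorm u : enorm u ^+ 2 = \sum_(i < n) u ord0 i ^+ 2.
Proof. by rewrite sqr_sqrtr// sumr_ge0// => i _; rewrite sqr_ge0. Qed.

Lemma enorm_ge0 u : 0 <= enorm u.
Proof. exact: sqrtr_ge0. Qed.

Lemma enorm0 : enorm (0 : 'rV[R]_n) = 0.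
Proof. by rewrite /enorm big1 ?sqrtr0// => i _; rewrite mxE expr0n. Qed.

Lemma enorm0_eq0 u : enorm u = 0 -> u = 0.
Proof.
move=> /(congr1 (fun x => x ^+ 2)); rewrite sqr_enorm expr0n => /eqP.
rewrite psumr_eq0 => [/allP h|i _]; last exact: sqr_ge0.
apply/rowP => i; rewrite mxE; apply/eqP; rewrite -sqrf_eq0.
by apply: h; rewrite mem_index_enum.
Qed.

Lemma enormZ k u : enorm (k *: u) = `|k| * enorm u.
Proof.
rewrite /enorm -sqrtr_sqr -sqrtrM ?sqr_ge0//; congr Num.sqrt.
by rewrite mulr_sumr; apply: eq_bigr => i _; rewrite mxE exprMn.
Qed.

Lemma enormN u : enorm (- u) = enorm u.
Proof. by rewrite -scaleN1r enormZ normrN normr1 mul1r. Qed.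

Lemma enormB u v : enorm (u - v) = enorm (v - u).
Proof. by rewrite -enormN opprB. Qed.

Lemma cauchy_schwarz u v :
  \sum_(i < n) u ord0 i * v ord0 i <= enorm u * enorm v.
Proof.
set s := \sum_(i < n) _; have [v0|v0] := eqVneq (enorm v) 0.
  rewrite v0 mulr0 /s big1// => i _.
  by rewrite (enorm0_eq0 v0) mxE mulr0.
have : 0 <= \sum_(i < n) (enorm v * enorm v * u ord0 i - s * v ord0 i) ^+ 2.
  by apply: sumr_ge0 => i _; rewrite sqr_ge0.
have -> : \sum_(i < n) (enorm v * enorm v * u ord0 i - s * v ord0 i) ^+ 2 =
   enorm v ^+ 2 * ((enorm u * enorm v) ^+ 2 - s ^+ 2).
  have expand k t : \sum_(i < n) (k * u ord0 i - t * v ord0 i) ^+ 2 =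
      k ^+ 2 * enorm u ^+ 2 - 2 * k * t * s + t ^+ 2 * enorm v ^+ 2.
    rewrite !sqr_enorm /s !mulr_sumr -sumrN -!big_split/=.
    by apply: eq_bigr => i _; ring.
  by rewrite expand; ring.
have v_gt0 : 0 < enorm v by rewrite lt_neqAle eq_sym v0 enorm_ge0.
rewrite pmulr_rge0 ?exprn_gt0// subr_ge0 => h.
have [s0|s0] := lerP s 0; first by rewrite (le_trans s0)// mulr_ge0// enorm_ge0.
by rewrite -(@ler_pXn2r _ 2)// nnegrE ?mulr_ge0 ?enorm_ge0// ltW.
Qed.

Lemma enormD u v : enorm (u + v) <= enorm u + enorm v.
Proof.
rewrite -(@ler_pXn2r _ 2)// ?nnegrE ?addr_ge0 ?enorm_ge0//.
have -> : enorm (u + v) ^+ 2 = enorm u ^+ 2 + enorm v ^+ 2 +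
    2 * \sum_(i < n) u ord0 i * v ord0 i.
  rewrite !sqr_enorm mulr_sumr -!big_split/=; apply: eq_bigr => i _.
  by rewrite mxE; ring.
by have := cauchy_schwarz u v; nra.
Qed.

(** Weights of sum 0 make the vector a combination of edge vectors, so its length depends on the six
    edge lengths alone. Legs and medians are measured this way. *)
Lemma sqr_enorm_bary A B C D a b c d : a + b + c + d = 0 ->
  enorm (a *: A + b *: B + c *: C + d *: D) ^+ 2 =
  - (a * b * enorm (A - B) ^+ 2 + a * c * enorm (A - C) ^+ 2
   + a * d * enorm (A - D) ^+ 2 + b * c * enorm (B - C) ^+ 2
   + b * d * enorm (B - D) ^+ 2 + c * d * enorm (C - D) ^+ 2).
Proof.
move=> abcd0; have -> : a = - (b + c + d) by lra.
rewrite !sqr_enorm !mulr_sumr -!big_split -sumrN/=.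
by apply: eq_bigr => i _; rewrite !mxE; ring.
Qed.

End Euclidean.

(** * Curve length and paths made of two segments *)

Section Paths.
Variables (R : realType) (n : nat).
Implicit Types (g : R -> 'rV[R]_n) (S : set 'rV[R]_n) (x y q : 'rV[R]_n).

Lemma chord_length_cons g (a b t : R) (s : seq R) :
  chord_length g a b (t :: s) = enorm (g t - g a) + chord_length g t b s.
Proof. by rewrite /chord_length big_nat_recl. Qed.

(** [L] dominates arc length, and its increments telescope along any partition. *)
Lemma curve_length_le g (L : R -> R) (a b : R) :
  (forall s t, a <= s -> s <= t -> t <= b -> enorm (g t - g s) <= L t - L s) ->
  (curve_length a b g <= (L b - L a)%:E)%E.
Proof.
move=> gL; apply: ge_ereal_sup => _ [s sP <-]; rewrite lee_fin.
elim: s a gL sP => [|t s IH] a gL sP.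
  by rewrite /chord_length big_geq// (itv_partition_nil sP) subrr.
have tb := itv_partition_le (itv_partition_cons sP).
have at_ : a <= t by case: sP => /= /andP[/ltW].
rewrite chord_length_cons.
have /= := IH t (fun u w tu => gL u w (le_trans at_ tu)) (itv_partition_cons sP).
by have := gL a t (lexx _) at_ tb; lra.
Qed.

Lemma intrinsic_dist_two_legs S x q y :
  (forall t : R, 0 <= t <= 1 -> S (x + t *: (q - x))) ->
  (forall t : R, 0 <= t <= 1 -> S (q + t *: (y - q))) ->
  (intrinsic_dist S x y <= (enorm (x - q) + enorm (q - y))%:E)%E.
Proof.
move=> Sxq Sqy.
(* The first leg is run on [[0, 1/2]] by [l], the second on [[1/2, 1]] by [r]; each is clamped while
   the other moves. *)
pose l : R -> R := fun t => Num.min (2 * t) 1.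
pose r : R -> R := fun t => Num.max (2 * t - 1) 0.
pose g : R -> 'rV[R]_n := fun t => x + l t *: (q - x) + r t *: (y - q).
have lrP (t : R) : 0 <= t <= 1 ->
    (l t = 2 * t /\ r t = 0 /\ 2 * t <= 1) \/
    (l t = 1 /\ r t = 2 * t - 1 /\ 1 <= 2 * t).
  rewrite /l /r => _; have [h|h] := leP (2 * t) 1.
    by left; split=> //; split=> //; apply/max_idPr; lra.
  by right; split=> //; split; [apply/max_idPl; lra|lra].
have l0 : l 0 = 0 by rewrite /l mulr0; apply/min_idPl; lra.
have l1 : l 1 = 1 by rewrite /l mulr1; apply/min_idPr; lra.
have r0 : r 0 = 0 by rewrite /r mulr0; apply/max_idPr; lra.
have r1 : r 1 = 1 by rewrite /r mulr1; apply/eqP; rewrite eq_le ge_max le_max; lra.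
have gS : path_on S x y g.
  split.
  - apply: continuous_subspaceT => t.
    have cl : {for t, continuous l}.
      by apply: continuous_min; [exact: mulrl_continuous|exact: cvg_cst].
    have cr : {for t, continuous r}.
      apply: continuous_max; last exact: cvg_cst.
      by apply: cvgB; [exact: mulrl_continuous|exact: cvg_cst].
    apply: cvgD; last by apply: cvgZr_tmp.
    by apply: cvgD; [exact: cvg_cst|apply: cvgZr_tmp].
  - move=> t; rewrite in_itv/= => t01; rewrite /g.
    have [[-> [-> h]]|[-> [-> h]]] := lrP _ t01.
      by rewrite scale0r addr0; apply: Sxq; lra.
    by rewrite scale1r addrCA subrr addr0; apply: Sqy; lra.
  - by rewrite /g l0 r0 !scale0r !addr0.
  - by rewrite /g l1 r1 !scale1r (addrCA x) subrr addr0 (addrCA q) subrr addr0.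
pose L : R -> R := fun t => l t * enorm (x - q) + r t * enorm (q - y).
have -> : enorm (x - q) + enorm (q - y) = L 1 - L 0.
  by rewrite /L l0 l1 r0 r1; ring.
apply: ge_ereal_inf; exists (curve_length 0 1 g); first by exists g.
apply: curve_length_le => s t s0 st t1.
have -> : g t - g s = (l t - l s) *: (q - x) + (r t - r s) *: (y - q).
  by apply/rowP => i; rewrite /g !mxE; ring.
apply: le_trans (enormD _ _) _; rewrite !enormZ (enormB q) (enormB y).
have sP := lrP s _; have tP := lrP t _.
have [lm rm] : l s <= l t /\ r s <= r t.
  by have [] := sP ltac:(lra); have [] := tP ltac:(lra); lra.
by rewrite !ger0_norm ?subr_ge0// /L; lra.
Qed.

End Paths.

(** * Upper bound: paths crossing one edge *)

Definition triangle (R : realType) (n : nat) (A B C : 'rV[R]_n) :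
    set 'rV[R]_n :=
  [set y | exists a b c : R, [/\ 0 <= a, 0 <= b, 0 <= c, a + b + c = 1 &
                                y = a *: A + b *: B + c *: C]].

Section UpperBound.
Variables (R : realType) (n : nat).
Implicit Types (S : set 'rV[R]_n) (A B C D E M p q x y : 'rV[R]_n) (K : R).

Lemma triangle_perm12 A B C : triangle A B C = triangle B A C.
Proof.
by rewrite eqEsubset; split=> y [a [b [c [a0 b0 c0 abc ->]]]]; exists b, a, c;
  split=> //; rewrite 1?(addrC b) 1?(addrC (b *: _)).
Qed.

Lemma enorm_triangle_le A B C x y K : triangle A B C x ->
  enorm (A - y) <= K -> enorm (B - y) <= K -> enorm (C - y) <= K ->
  enorm (x - y) <= K.
Proof.
move=> [a [b [c [a0 b0 c0 abc xE]]]] Ay By Cy.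
have -> : x - y = a *: (A - y) + (b *: (B - y) + c *: (C - y)).
  apply/rowP => i; rewrite xE !mxE (_ : a = 1 - b - c); [ring|lra].
apply: le_trans (enormD _ _) _.
have := enormD (b *: (B - y)) (c *: (C - y)).
rewrite !enormZ !ger0_norm//.
have := ler_wpM2l a0 Ay; have := ler_wpM2l b0 By; have := ler_wpM2l c0 Cy.
have : a * K + b * K + c * K = K by rewrite -!mulrDl abc mul1r.
by lra.
Qed.

(** The crossing point [q] on AC moves affinely with [y], so the length of the two-legged path is
    convex in [y]. It is at most [K] at the corners A and C, where the second leg vanishes, and at
    E, where [q = p]. *)
Lemma intrinsic_dist_hinge S M A C E K (s : R) y : 0 <= s <= 1 ->
  let p := (1 - s) *: A + s *: C in
  triangle M A C `<=` S -> triangle A C E `<=` S ->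
  enorm (M - A) <= K -> enorm (M - C) <= K ->
  enorm (M - p) + enorm (p - E) <= K ->
  triangle A C E y -> (intrinsic_dist S M y <= K%:E)%E.
Proof.
move=> s01 p MACS ACES MA MC MpE [a [c [e [a0 c0 e0 ace ->]]]].
pose q := a *: A + c *: C + e *: p.
apply: (@le_trans _ _ (enorm (M - q) + enorm (q - (a *: A + c *: C + e *: E)))%:E).
  apply: intrinsic_dist_two_legs => t t01.
    apply: MACS; exists (1 - t), (t * (a + e * (1 - s))), (t * (c + e * s)).
    split; [lra| | | |].
    - by rewrite mulr_ge0 ?addr_ge0 ?mulr_ge0//; lra.
    - by rewrite mulr_ge0 ?addr_ge0 ?mulr_ge0//; lra.
    - by rewrite (_ : a = 1 - c - e); [ring|lra].
    - by apply/rowP => i; rewrite /q /p !mxE; ring.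
  apply: ACES; exists (a + (1 - t) * e * (1 - s)), (c + (1 - t) * e * s), (t * e).
  split; [ | |by rewrite mulr_ge0//; lra|by rewrite (_ : a = 1 - c - e); [ring|lra]|].
  - by rewrite addr_ge0// !mulr_ge0//; lra.
  - by rewrite addr_ge0// !mulr_ge0//; lra.
  - by apply/rowP => i; rewrite /q /p !mxE; ring.
rewrite lee_fin.
have -> : q - (a *: A + c *: C + e *: E) = e *: (p - E).
  by apply/rowP => i; rewrite /q !mxE; ring.
have -> : M - q = a *: (M - A) + (c *: (M - C) + e *: (M - p)).
  apply/rowP => i; rewrite /q !mxE (_ : a = 1 - c - e); [ring|lra].
have := enormD (a *: (M - A)) (c *: (M - C) + e *: (M - p)).
have := enormD (c *: (M - C)) (e *: (M - p)).
rewrite !enormZ !ger0_norm//.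
have := ler_wpM2l a0 MA; have := ler_wpM2l c0 MC; have := ler_wpM2l e0 MpE.
have : a * K + c * K + e * K = K by rewrite -!mulrDl ace mul1r.
by rewrite mulrDr; lra.
Qed.

(** The segment AE cuts the face ACD in two. Points on the C side are reached across AC, those on
    the D side across AD; the sign of [c s - d (1 - s)] tells the side. *)
Lemma intrinsic_dist_two_hinges S M A C D K (s1 s2 s : R) :
  0 <= s1 <= 1 -> 0 <= s2 <= 1 -> 0 < s < 1 ->
  let p1 := (1 - s1) *: A + s1 *: C in
  let p2 := (1 - s2) *: A + s2 *: D in
  let E := (1 - s) *: C + s *: D in
  triangle M A C `<=` S -> triangle M A D `<=` S -> triangle A C D `<=` S ->
  enorm (M - A) <= K -> enorm (M - C) <= K -> enorm (M - D) <= K ->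
  enorm (M - p1) + enorm (p1 - E) <= K ->
  enorm (M - p2) + enorm (p2 - E) <= K ->
  forall y, triangle A C D y -> (intrinsic_dist S M y <= K%:E)%E.
Proof.
move=> s101 s201 s01.
have [s_gt0 s'_gt0] : 0 < s /\ 0 < 1 - s by lra.
have s0 : s != 0 by rewrite gt_eqF.
have s'0 : 1 - s != 0 by rewrite gt_eqF.
have [/ltW s_ge0 /ltW s'_ge0] := (s_gt0, s'_gt0).
move=> p1 p2 E MAC MAD ACD MA MC MD h1 h2 y.
case=> [a [c [d [a0 c0 d0 acd ->]]]].
have [h|h] := lerP (d * (1 - s)) (c * s).
  apply: (@intrinsic_dist_hinge S M A C E K s1) => //.
    move=> _ [a' [c' [e [a'0 c'0 e0 ace ->]]]]; apply: ACD.
    exists a', (c' + e * (1 - s)), (e * s).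
    split=> //; [by rewrite addr_ge0 ?mulr_ge0|by rewrite mulr_ge0|lra|].
    by apply/rowP => i; rewrite !mxE; ring.
  exists a, (c - d / s * (1 - s)), (d / s).
  split=> //; [|by rewrite divr_ge0| |].
  - by rewrite subr_ge0 mulrAC ler_pdivrMr.
  - by rewrite (_ : a = 1 - c - d); [field|lra].
  - by apply/rowP => i; rewrite !mxE; field.
apply: (@intrinsic_dist_hinge S M A D E K s2) => //.
  move=> _ [a' [d' [e [a'0 d'0 e0 ade ->]]]]; apply: ACD.
  exists a', (e * (1 - s)), (d' + e * s).
  split=> //; [by rewrite mulr_ge0|by rewrite addr_ge0 ?mulr_ge0|lra|].
  by apply/rowP => i; rewrite !mxE; ring.
exists a, (d - c / (1 - s) * s), (c / (1 - s)).
split=> //; [|by rewrite divr_ge0| |].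
- by rewrite subr_ge0 mulrAC ler_pdivrMr// ltW.
- by rewrite (_ : a = 1 - c - d); [field|lra].
- by apply/rowP => i; rewrite !mxE; field.
Qed.

End UpperBound.

(* The sum of the squared lengths of the two legs from the midpoint of AB to
   (1 - s) A + s C and on to (1 - t) C + t D, in terms of the squared edge
   lengths. *)
Definition sqr_legs (R : realFieldType) (AB AC AD BC CD s t : R) : R :=
  s / 2 * BC + s * (s - 1 / 2) * AC - (s - 1 / 2) / 2 * AB
  + (1 - s) * t * AD + t * (s + t - 1) * CD - (1 - s) * (s + t - 1) * AC.

(** All lengths are squared. The two sums belong to the paths across AC and AD, the second with C
    and D exchanged. At the midpoints they equal [(BC + AD) / 4] and [(BD + AC) / 4], so a
    perturbation is called for only when one or both of these reach [L / 2]. *)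
Lemma sqr_legs_lt (R : realFieldType) (L AC AD BC BD CD : R) :
  0 < CD -> 0 <= AC <= L -> 0 <= AD <= L -> 0 <= BC <= L -> 0 <= BD <= L ->
  CD <= L -> ~ [/\ AC = L, AD = L, BC = L, BD = L & CD = L] ->
  exists s1 s2 t : R, [/\ 0 <= s1 <= 1, 0 <= s2 <= 1, 0 < t < 1,
    sqr_legs L AC AD BC CD s1 t < L / 2 &
    sqr_legs L AD AC BD CD s2 (1 - t) < L / 2].
Proof.
move=> CD0 ACL ADL BCL BDL CDL nreg.
have L0 : 0 < L by lra.
(* At t = 1 / 2 both legs have squared length L / 4 when BC = AD = L, but the
   angle at N towards C is acute, so it pays to move N towards C. *)
have shift AC' AD' BC' BD' : BC' = L -> AD' = L -> 0 <= BD' -> 0 <= AC' <= L ->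
    BD' + AC' < L + L ->
    exists t : R, [/\ 0 < t < 1, sqr_legs L AC' AD' BC' CD (1 / 2) t < L / 2 &
      sqr_legs L AD' AC' BD' CD (1 / 2) (1 - t) < L / 2].
  move=> -> -> BD0 AC0 lt2.
  (* Moving [t] to [1/2 - e] lowers the first sum by at least [e (1/2 - e) CD] and raises the second
     by at most [e (1/2 + e) CD], less than its slack [2 e L]. *)
  pose e := (2 * L - BD' - AC') / (8 * L).
  have eL : 8 * (e * L) = 2 * L - BD' - AC' by rewrite /e; field; lra.
  have e0 : 0 < e by rewrite divr_gt0//; lra.
  have e1 : e <= 1 / 4 by rewrite ler_pdivrMr; lra.
  have eCD : e * e * CD <= 1 / 4 * (e * CD) by rewrite -mulrA ler_wpM2r// mulr_ge0//; lra.
  have eCD0 : 0 < e * CD by rewrite mulr_gt0.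
  have eCDL : e * CD <= e * L by rewrite ler_wpM2l//; lra.
  have eACL : e * AC' <= e * L by rewrite ler_wpM2l//; lra.
  by exists (1 / 2 - e); rewrite /sqr_legs; split; lra.
have [BCAD|BCAD] := ltP (BC + AD) (L + L).
  have [BDAC|BDAC] := ltP (BD + AC) (L + L).
    by exists (1 / 2), (1 / 2), (1 / 2); rewrite /sqr_legs; split; lra.
  have [] := shift AD AC BD BC; rewrite ?(addrC BC); try lra.
  move=> t [t01 h1 h2]; exists (1 / 2), (1 / 2), (1 - t); split; try lra.
  by rewrite subKr.
have [BDAC|BDAC] := ltP (BD + AC) (L + L).
  have [] := shift AC AD BC BD; try lra.
  by move=> t [t01 h1 h2]; exists (1 / 2), (1 / 2), t; split; lra.
have [-> -> -> ->] : [/\ BC = L, AD = L, BD = L & AC = L] by split; lra.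
have CDltL : CD < L.
  by rewrite lt_neqAle CDL andbT; apply/eqP => CDL'; apply: nreg; split; lra.
(* Only CD is short here. With both crossing points at [1/2 + e] the sums change by
   [2 e^2 L - e (L - CD) / 2]; this [e] minimises the change and makes it [-2 e^2 L]. *)
pose e := (L - CD) / (8 * L).
have eL : 8 * (e * L) = L - CD by rewrite /e; field; lra.
have e0 : 0 < e by rewrite divr_gt0//; lra.
have e1 : e <= 1 / 8 by rewrite ler_pdivrMr; lra.
have eCD : e * (8 * (e * L)) = e * (L - CD) by rewrite eL.
have eeL : 0 < e * (e * L) := mulr_gt0 e0 (mulr_gt0 e0 L0).
by exists (1 / 2 + e), (1 / 2 + e), (1 / 2); rewrite /sqr_legs; split; lra.
Qed.

(** * Distances from the midpoint of a longest edge *)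

Section Midpoint.
Variables (R : realType) (n : nat).
Implicit Types (A B C D M p E : 'rV[R]_n).

(** AM-GM on each leg trades the lengths for their squares, without loss when both legs are [l / 2]:
    squares adding up to at most [l^2 / 2] give a path of length at most [l]. *)
Lemma enorm_legs A B C D M p E (l s t : R) : M = (1 / 2) *: (A + B) ->
  p = (1 - s) *: A + s *: C -> E = (1 - t) *: C + t *: D -> 0 < l ->
  enorm (M - p) + enorm (p - E) <= l / 2 +
    sqr_legs (enorm (A - B) ^+ 2) (enorm (A - C) ^+ 2) (enorm (A - D) ^+ 2)
     (enorm (B - C) ^+ 2) (enorm (C - D) ^+ 2) s t / l.
Proof.
move=> ME pE EE l0.
have -> : sqr_legs (enorm (A - B) ^+ 2) (enorm (A - C) ^+ 2)
    (enorm (A - D) ^+ 2) (enorm (B - C) ^+ 2) (enorm (C - D) ^+ 2) s t =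
    enorm (M - p) ^+ 2 + enorm (p - E) ^+ 2.
  have -> : M - p = (s - 1 / 2) *: A + (1 / 2) *: B + (- s) *: C + 0 *: D.
    by apply/rowP => i; rewrite ME pE !mxE; field.
  have -> : p - E = (1 - s) *: A + 0 *: B + (s + t - 1) *: C + (- t) *: D.
    by apply/rowP => i; rewrite EE pE !mxE; field.
  have c1 : s - 1 / 2 + 1 / 2 + - s + 0 = 0 by field.
  have c2 : 1 - s + 0 + (s + t - 1) + - t = 0 by ring.
  rewrite (sqr_enorm_bary A B C D c1) (sqr_enorm_bary A B C D c2) /sqr_legs.
  by field.
(* AM-GM in the form x <= l / 4 + x ^ 2 / l, with equality at x = l / 2 *)
have amgm x : x <= l / 4 + x ^+ 2 / l.
  rewrite -subr_ge0 (_ : _ - x = (x - l / 2) ^+ 2 / l).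
    by rewrite divr_ge0 ?sqr_ge0// ltW.
  by field; rewrite gt_eqF.
by have := amgm (enorm (M - p)); have := amgm (enorm (p - E)); rewrite mulrDl; lra.
Qed.

(** The squared median is at most [3/4 l^2]; [7/8] is a rational bound for [sqrt 3 / 2] that stays
    below 1. *)
Lemma enorm_median A B C (l : R) : 0 <= l -> enorm (A - B) = l ->
  enorm (A - C) <= l -> enorm (B - C) <= l ->
  enorm ((1 / 2) *: (A + B) - C) <= 7 / 8 * l.
Proof.
move=> l0 AB AC BC; rewrite -(@ler_pXn2r _ 2)// ?nnegrE ?enorm_ge0//; last by lra.
have -> : (1 / 2) *: (A + B) - C = (1 / 2) *: A + (1 / 2) *: B + (- 1) *: C + 0 *: C.
  by apply/rowP => i; rewrite !mxE; field.
rewrite sqr_enorm_bary; last by field.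
rewrite AB; have : enorm (A - C) ^+ 2 <= l ^+ 2.
  by rewrite lerXn2r ?nnegrE ?enorm_ge0.
have : enorm (B - C) ^+ 2 <= l ^+ 2 by rewrite lerXn2r ?nnegrE ?enorm_ge0.
by have := sqr_ge0 l; rewrite subrr enorm0 exprMn; lra.
Qed.

End Midpoint.

Section LongestEdge.
Variables (R : realType) (n : nat).
Implicit Types (S : set 'rV[R]_n) (A B C D M x y : 'rV[R]_n).

Lemma triangle_mid A B C : triangle ((1 / 2) *: (A + B)) A C `<=` triangle A B C.
Proof.
move=> _ [a [b [c [a0 b0 c0 abc ->]]]]; exists (a / 2 + b), (a / 2), c.
split; [lra|lra|lra|lra|].
by apply/rowP => i; rewrite !mxE; field.
Qed.

Lemma intrinsic_dist_flat S A B C x y (k : R) : triangle A B C `<=` S ->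
  triangle A B C x -> triangle A B C y ->
  enorm (A - x) <= k -> enorm (B - x) <= k -> enorm (C - x) <= k ->
  (intrinsic_dist S x y <= k%:E)%E.
Proof.
move=> ABCS [a' [b' [c' [a'0 b'0 c'0 abc' xE]]]] [a [b [c [a0 b0 c0 abc yE]]]] xA xB xC.
apply: (@le_trans _ _ (enorm (x - y) + enorm (y - y))%:E).
  apply: intrinsic_dist_two_legs => t /andP[t0 t1]; apply: ABCS.
    exists ((1 - t) * a' + t * a), ((1 - t) * b' + t * b), ((1 - t) * c' + t * c).
    have t1' : 0 <= 1 - t by lra.
    split; [by rewrite addr_ge0 ?mulr_ge0|by rewrite addr_ge0 ?mulr_ge0|
      by rewrite addr_ge0 ?mulr_ge0| |].
      have := congr1 (fun u => (1 - t) * u) abc'; have := congr1 (fun u => t * u) abc.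
      by rewrite /= !mulr1; lra.
    by apply/rowP => i; rewrite xE yE !mxE; ring.
  exists a, b, c; split=> //.
  by rewrite subrr scaler0 addr0.
rewrite subrr enorm0 addr0 lee_fin enormB.
by apply: (enorm_triangle_le _ xA xB xC) => //; exists a, b, c.
Qed.

(** A single [k] serves the weak and the strict bound: the maximum of [7/8 l], which settles the
    faces on AB, and of the lengths of the two paths to E. *)
Lemma midpoint_dist_le S A B C D M (l : R) :
  triangle A B C `<=` S -> triangle A B D `<=` S -> triangle A C D `<=` S ->
  M = (1 / 2) *: (A + B) -> enorm (A - B) = l ->
  enorm (A - C) <= l -> enorm (A - D) <= l -> enorm (B - C) <= l ->
  enorm (B - D) <= l -> enorm (C - D) <= l -> 0 < enorm (C - D) ->
  exists k, [/\ k <= l,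
    (~ [/\ enorm (A - C) = l, enorm (A - D) = l, enorm (B - C) = l,
           enorm (B - D) = l & enorm (C - D) = l] -> k < l) &
    forall y, [\/ triangle A B C y, triangle A B D y | triangle A C D y] ->
      (intrinsic_dist S M y <= k%:E)%E].
Proof.
move=> ABC ABD ACD ME AB AC AD BC BD CD CD0.
have l0 : 0 < l by lra.
have MA : enorm (M - A) = l / 2.
  rewrite (_ : M - A = (- (1 / 2)) *: (A - B)).
    by rewrite enormZ normrN ger0_norm ?AB//; lra.
  by apply/rowP => i; rewrite ME !mxE; field.
have MB : enorm (M - B) = l / 2.
  rewrite (_ : M - B = (1 / 2) *: (A - B)).
    by rewrite enormZ ger0_norm ?AB//; lra.
  by apply/rowP => i; rewrite ME !mxE; field.
have MC : enorm (M - C) <= 7 / 8 * l by rewrite ME enorm_median// ltW.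
have MD : enorm (M - D) <= 7 / 8 * l by rewrite ME enorm_median// ltW.
have MABC X : triangle A B X M.
  exists (1 / 2), (1 / 2), 0; split; [lra|lra|lra|lra|].
  by apply/rowP => i; rewrite ME !mxE; field.
have sq_le (x : R) : 0 <= x -> x <= l -> 0 <= x ^+ 2 <= l ^+ 2.
  by move=> x0 xl; rewrite sqr_ge0/= lerXn2r ?nnegrE// ltW.
pose nreg := ~ [/\ enorm (A - C) = l, enorm (A - D) = l, enorm (B - C) = l,
           enorm (B - D) = l & enorm (C - D) = l].
pose legs1 s t := sqr_legs (enorm (A - B) ^+ 2) (enorm (A - C) ^+ 2)
  (enorm (A - D) ^+ 2) (enorm (B - C) ^+ 2) (enorm (C - D) ^+ 2) s t.
pose legs2 s t := sqr_legs (enorm (A - B) ^+ 2) (enorm (A - D) ^+ 2)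
  (enorm (A - C) ^+ 2) (enorm (B - D) ^+ 2) (enorm (D - C) ^+ 2) s (1 - t).
have [s1 [s2 [t [s101 s201 t01 [h1 h2] h]]]] : exists s1 s2 t : R, [/\
    0 <= s1 <= 1, 0 <= s2 <= 1, 0 < t < 1,
    legs1 s1 t <= l ^+ 2 / 2 /\ legs2 s2 t <= l ^+ 2 / 2 &
    nreg -> legs1 s1 t < l ^+ 2 / 2 /\ legs2 s2 t < l ^+ 2 / 2].
  rewrite /legs1 /legs2 AB (enormB D).
  have [reg|] := pselect (~ nreg).
    exists (1 / 2), (1 / 2), (1 / 2); split=> //; [lra|lra|lra|split].
    - by have := sq_le _ (enorm_ge0 _) BC; have := sq_le _ (enorm_ge0 _) AD;
        rewrite /sqr_legs; lra.
    - by have := sq_le _ (enorm_ge0 _) BD; have := sq_le _ (enorm_ge0 _) AC;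
        rewrite /sqr_legs; lra.
  rewrite not_notE => nr.
  have [||||||nr'|s1 [s2 [t [? ? ? ? ?]]]] := @sqr_legs_lt R (l ^+ 2)
    (enorm (A - C) ^+ 2) (enorm (A - D) ^+ 2) (enorm (B - C) ^+ 2)
    (enorm (B - D) ^+ 2) (enorm (C - D) ^+ 2).
  - by rewrite exprn_gt0.
  - exact: sq_le (enorm_ge0 _) AC.
  - exact: sq_le (enorm_ge0 _) AD.
  - exact: sq_le (enorm_ge0 _) BC.
  - exact: sq_le (enorm_ge0 _) BD.
  - by have /andP[] := sq_le _ (enorm_ge0 _) CD.
  - case: nr' => e1 e2 e3 e4 e5; apply: nr.
    have sqr_inj (x : R) : 0 <= x -> x ^+ 2 = l ^+ 2 -> x = l.
      by move=> x0 /eqP; rewrite eqrXn2 ?(ltW l0)// => /eqP.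
    by split; apply: sqr_inj; rewrite ?enorm_ge0.
  - by exists s1, s2, t; split=> //; split; exact: ltW.
pose p1 := (1 - s1) *: A + s1 *: C; pose p2 := (1 - s2) *: A + s2 *: D.
pose E := (1 - t) *: C + t *: D.
pose d1 := enorm (M - p1) + enorm (p1 - E); pose d2 := enorm (M - p2) + enorm (p2 - E).
have d1_le : d1 <= l / 2 + legs1 s1 t / l by apply: enorm_legs.
have d2_le : d2 <= l / 2 + legs2 s2 t / l.
  by apply: enorm_legs => //; rewrite /E subKr addrC.
have half (x : R) : x <= l ^+ 2 / 2 -> l / 2 + x / l <= l.
  by move=> hx; rewrite -lerBrDl ler_pdivrMr// -[X in _ <= X * _]mul1r; lra.
have halfs (x : R) : x < l ^+ 2 / 2 -> l / 2 + x / l < l.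
  by move=> hx; rewrite -ltrBrDl ltr_pdivrMr//; lra.
exists (Num.max (7 / 8 * l) (Num.max d1 d2)); split.
- by rewrite !ge_max (le_trans d1_le (half _ h1)) (le_trans d2_le (half _ h2)); lra.
- move=> /h[k1 k2]; rewrite !gt_max (le_lt_trans d1_le (halfs _ k1)).
  by rewrite (le_lt_trans d2_le (halfs _ k2)); lra.
set k := Num.max _ _.
have k78 : 7 / 8 * l <= k by rewrite le_max lexx.
have MAk : enorm (M - A) <= k by lra.
have MBk : enorm (M - B) <= k by rewrite MB -MA.
have MCk := le_trans MC k78; have MDk := le_trans MD k78.
have kd1 : d1 <= k by rewrite !le_max lexx orbT.
have kd2 : d2 <= k by rewrite !le_max lexx !orbT.
move=> y [yABC|yABD|yACD].
- by apply: (intrinsic_dist_flat ABC) => //; rewrite enormB.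
- by apply: (intrinsic_dist_flat ABD) => //; rewrite enormB.
have MACS : triangle M A C `<=` S.
  by apply: subset_trans ABC; rewrite ME; exact: triangle_mid.
have MADS : triangle M A D `<=` S.
  by apply: subset_trans ABD; rewrite ME; exact: triangle_mid.
by apply: (intrinsic_dist_two_hinges s101 s201 t01 MACS MADS ACD MAk
  MCk MDk kd1 kd2).
Qed.

Lemma Rad_le S x (k : \bar R) :
  S x -> (forall y, S y -> intrinsic_dist S x y <= k)%E -> (Rad S <= k)%E.
Proof.
move=> Sx h; apply: ge_ereal_inf.
exists (ereal_sup [set intrinsic_dist S x y | y in S]); first by exists x.
by apply: ge_ereal_sup => _ [y Sy <-]; exact: h.
Qed.

Lemma Rad_le_longest_edge A B C D S (l : R) :
  S = triangle A B C `|` triangle A B D `|` triangle A C D `|` triangle B C D ->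
  enorm (A - B) = l ->
  enorm (A - C) <= l -> enorm (A - D) <= l -> enorm (B - C) <= l ->
  enorm (B - D) <= l -> enorm (C - D) <= l -> 0 < enorm (C - D) ->
  (Rad S <= l%:E)%E /\
  (~ [/\ enorm (A - C) = l, enorm (A - D) = l, enorm (B - C) = l,
         enorm (B - D) = l & enorm (C - D) = l] -> (Rad S < l%:E)%E).
Proof.
move=> SE AB AC AD BC BD CD CD0.
have ABCS : triangle A B C `<=` S by rewrite SE => y; left; left; left.
have ABDS : triangle A B D `<=` S by rewrite SE => y; left; left; right.
have ACDS : triangle A C D `<=` S by rewrite SE => y; left; right.
have BCDS : triangle B C D `<=` S by rewrite SE => y; right.
pose M := (1 / 2) *: (A + B).
have [k [kl klt kP]] := midpoint_dist_le ABCS ABDS ACDS (erefl M) AB AC AD BC BD CD CD0.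
(* Exchanging A and B fixes M and carries ACD to BCD, the remaining face. *)
have [||||k' [kl' klt' kP']] := @midpoint_dist_le S B A C D M l _ _ BCDS _ _ BC BD AC AD CD CD0.
- by rewrite triangle_perm12.
- by rewrite triangle_perm12.
- by rewrite /M addrC.
- by rewrite enormB.
have RadS : (Rad S <= (Num.max k k')%:E)%E.
  apply: (@Rad_le S M).
    apply: ABCS; exists (1 / 2), (1 / 2), 0; split; [lra|lra|lra|lra|].
    by apply/rowP => i; rewrite /M !mxE; field.
  move=> y; rewrite {1}SE => -[[[yf|yf]|yf]|yf].
  - by apply: (le_trans (kP y _)); [exact: Or31|rewrite lee_fin le_max lexx].
  - by apply: (le_trans (kP y _)); [exact: Or32|rewrite lee_fin le_max lexx].
  - by apply: (le_trans (kP y _)); [exact: Or33|rewrite lee_fin le_max lexx].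
  - by apply: (le_trans (kP' y _)); [exact: Or33|rewrite lee_fin le_max lexx orbT].
split; first by apply: le_trans RadS _; rewrite lee_fin ge_max kl kl'.
move=> nreg; apply: le_lt_trans RadS _.
by rewrite lte_fin gt_max klt// klt'// => -[*]; apply: nreg.
Qed.

End LongestEdge.

(** * Lower bound: curves compared with chains of chords *)

Lemma closed_triangle (R : realType) (n : nat) (A B C : 'rV[R]_n) :
  closed (triangle A B C).
Proof.
(* The triangle is a continuous image of the compact unit square, whose side [z.1 = 0] collapses to
   A. *)
pose f (z : R * R) := A + z.1 *: (B - A) + (z.1 * z.2) *: (C - B).
have -> : triangle A B C = f @` (`[0, 1] `*` `[0, 1]).
  rewrite eqEsubset; split=> [_ [a [b [c [a0 b0 c0 abc ->]]]]|_ [[s t] /= [s01 t01] <-]].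
    have [bc0|bc0] := eqVneq (b + c) 0.
      exists (0, 0); first by rewrite /= !in_itv/= lexx ler01.
      have [-> -> ->] : [/\ a = 1, b = 0 & c = 0] by split; lra.
      by apply/rowP => i; rewrite /f !mxE/=; ring.
    have bc_gt0 : 0 < b + c by rewrite lt_neqAle eq_sym bc0 addr_ge0.
    exists (b + c, c / (b + c)).
      rewrite /= !in_itv/= divr_ge0 ?(ltW bc_gt0)//= ler_pdivrMr// mul1r.
      by split; lra.
    by apply/rowP => i; rewrite /f !mxE/= (_ : a = 1 - b - c); [field|lra].
  move: s01 t01; rewrite !in_itv/= => /andP[s0 s1] /andP[t0 t1].
  exists (1 - s), (s * (1 - t)), (s * t).
  split; [lra|by rewrite mulr_ge0//; lra|by rewrite mulr_ge0|ring|].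
  by apply/rowP => i; rewrite /f !mxE/=; ring.
apply: compact_closed; first exact: norm_hausdorff.
apply: continuous_compact; last by apply: compact_setX; exact: segment_compact.
apply: continuous_subspaceT => z.
apply: cvgD; first apply: cvgD; first exact: cvg_cst.
  by apply: cvgZr_tmp; exact: cvg_fst.
by apply: cvgZr_tmp; apply: cvgM; [exact: cvg_fst|exact: cvg_snd].
Qed.

Section Chains.
Variables (R : realType) (n : nat) (g : R -> 'rV[R]_n).
Variables (I : eqType) (K : I -> set R).
Hypothesis K_closed : forall i, closed (K i).

Lemma closed_cover (s : seq I) : closed [set t | exists2 i, i \in s & K i t].
Proof.
elim: s => [|i s IH].
  rewrite (_ : mkset _ = set0); first exact: closed0.
  by rewrite eqEsubset; split=> t // -[].
rewrite (_ : mkset _ = K i `|` [set t | exists2 i, i \in s & K i t]).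
  exact: closedU.
rewrite eqEsubset; split=> t /= [].
- move=> j; rewrite inE => /orP[/eqP ->|js] Kt; [by left|by right; exists j].
- by move=> Kt; exists i; rewrite ?mem_head.
- by move=> [j js Kt]; exists j; rewrite // inE js orbT.
Qed.

(* Jump from the current time to the last time spent in the current set; that
   set is never met again, so the number of jumps is bounded. *)
Lemma chord_chain (P : R -> R -> Prop) :
  (forall i t u r, K i t -> K i u -> P t r -> P u (r + enorm (g u - g t))) ->
  forall (s : seq I) (a b r : R), a <= b ->
  (forall t, a <= t <= b -> exists2 i, i \in s & K i t) -> P a r ->
  exists2 p, itv_partition a b p & P b (r + chord_length g a b p).
Proof.
move=> step s; have [m] := ubnP (size s); elim: m s => // m IH s sm a b r ab cover Par.
have [i si Kia] : exists2 i, i \in s & K i a by apply: cover; rewrite lexx.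
(* [w] is the last time up to [b] spent in [K i]; it belongs to [K i] because that set is closed. *)
pose E := K i `&` `[a, b]; pose w := sup E.
have Ea : E a by split=> //=; rewrite in_itv/= lexx.
have ubE : ubound E b by move=> t [_]; rewrite /= in_itv/= => /andP[].
have Ew : E w.
  have : closure E w by apply: closure_sup; [exists a|exists b].
  by rewrite -(closure_id E).1//; apply: closedI => //; exact: itv_closed.
have [Kw /=] := Ew; rewrite in_itv/= => /andP[aw wb].
have wE t : E t -> t <= w by move=> Et; apply: ub_le_sup => //; exists b.
have Pw := step _ _ _ _ Kia Kw Par.
have [p pP Pp] : exists2 p, itv_partition w b p &
    P b (r + enorm (g w - g a) + chord_length g w b p).
  have [wEb|w_neq_b] := eqVneq w b.
    rewrite -wEb; exists [::]; first by split=> //=.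
    by rewrite /chord_length big_geq// addr0.
  have wltb : w < b by rewrite lt_neqAle w_neq_b.
  pose s' := [seq j <- s | j != i].
  apply: (IH s') => //.
    rewrite -ltnS (leq_trans _ sm)// ltnS size_filter -(count_predC (pred1 i) s).
    by rewrite -[X in (X < _)%N]add0n ltn_add2r -has_count has_pred1.
  have cover' t : w < t <= b -> exists2 j, j \in s' & K j t.
    move=> /andP[wt tb].
    have atb : a <= t <= b by rewrite tb (le_trans aw (ltW wt)).
    have [j js Kj] := cover t atb; exists j => //; rewrite mem_filter js andbT.
    apply: contraTneq wt => ji; rewrite -leNgt; apply: wE.
    by rewrite /E -ji; split=> //=; rewrite in_itv.
  move=> t /andP[wt tb]; move: wt; rewrite le_eqVlt => /orP[/eqP <-|wt]; last first.
    by apply: cover'; rewrite wt.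
  (* Without [i] the sets still cover all times after [w]; being finitely many and closed, they also
     cover the limit [w]. *)
  apply: (@closed_cover s' w) => B /nbhs_ballP[e /= e0 eB].
  exists (Num.min (w + e / 2) b); split.
    by apply: cover'; rewrite lt_min ge_min lexx wltb orbT !andbT; lra.
  apply: eB; rewrite /ball/= ltr_distlC.
  by have [h|h] := leP (w + e / 2) b; lra.
(* A partition is strictly increasing, so [w] is prepended only if it differs from [a]. *)
have [aw'|aw'] := eqVneq a w.
  by exists p; rewrite -?aw'// aw' in pP Pp *; rewrite ?aw' ?subrr ?enorm0 ?addr0 in Pp *.
exists (w :: p); first by case: pP => pP1 pP2; split; rewrite //= pP1 lt_neqAle aw' aw.
by rewrite chord_length_cons addrA.
Qed.

End Chains.

Lemma curve_length_ge (R : realType) (n : nat) (g : R -> 'rV[R]_n) (a b : R)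
    (p : seq R) :
  itv_partition a b p -> ((chord_length g a b p)%:E <= curve_length a b g)%E.
Proof. by move=> pP; apply: ereal_sup_ubound; exists p. Qed.

(** [P p r] is an invariant kept by every chord between two points of one [F i], with [r] the length
    travelled so far. It reaches [y] along a chain of chords inscribed in the curve, whose total
    length is at least [k] and at most that of the curve. *)
Lemma path_chain (R : realType) (n : nat) (S : set 'rV[R]_n) (I : finType)
    (F : I -> set 'rV[R]_n) (P : 'rV[R]_n -> R -> Prop) (x y : 'rV[R]_n) (k : R) :
  S `<=` \bigcup_i F i -> (forall i, closed (F i)) ->
  (forall i p q r, F i p -> F i q -> P p r -> P q (r + enorm (q - p))) ->
  P x 0 -> (forall r, P y r -> k <= r) -> (k%:E <= intrinsic_dist S x y)%E.
Proof.
move=> SF F_closed step Px Py.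
apply: le_ereal_inf_tmp => _ [g [gc gS g0 g1] <-].
pose K i := (g @^-1` F i) `&` `[0, 1].
have K_closed i : closed (K i).
  have /continuous_closedP/(_ _ (F_closed i))/closed_subspaceP[V Vc VE] := gc.
  by rewrite /K -VE; apply: closedI => //; exact: itv_closed.
have [|t t01||p pP Pp] := @chord_chain R n g I K K_closed (fun t => P (g t)) _
  (enum I) 0 1 0 ler01 _ _.
- by move=> i t u r [Kt _] [Ku _]; exact: step Kt Ku.
- have [i _ Fi] := SF _ (gS t t01).
  by exists i; rewrite ?mem_enum//; split.
- by rewrite g0.
rewrite add0r g1 in Pp; apply: le_trans (curve_length_ge _ pP).
by rewrite lee_fin; exact: Py.
Qed.

(* Unfolding of a regular tetrahedron ABCD into the plane, in the coordinates
   with origin A and basis B - A, C - A. The faces ABC, BCD, ACD, ABD have the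
   indices 0, 1, 2, 3; a point has barycentric coordinates a, b, c, d. *)
Definition missing_weight (R : realType) (i : 'I_4) (a b c d : R) : R :=
  nth 0 [:: d; a; b; c] i.

Definition chart (R : realType) (i : 'I_4) (a b c d : R) : R * R :=
  nth (0, 0) [:: (b, c); (b + d, c + d); (- d, c + d); (b + d, - d)] i.

(* Same orbit under the group generated by the half-turns about the points
   with integer coordinates; the tetrahedron is the quotient of the plane by
   this group. *)
Definition same_orbit (R : realType) (z z' : R * R) : Prop :=
  exists (e : R) (m n : int), [/\ e = 1 \/ e = -1,
    z.1 = e * z'.1 + 2 * m%:~R & z.2 = e * z'.2 + 2 * n%:~R].

Lemma ord4_cases (P : 'I_4 -> Prop) : P (inord 0) -> P (inord 1) ->
  P (inord 2) -> P (inord 3) -> forall i, P i.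
Proof.
move=> P0 P1 P2 P3 i; rewrite -(inord_val i).
by case: i => -[|[|[|[|//]]]].
Qed.

(** * Half-turn orbits in the unfolded plane *)

Section Unfolding.
Variable R : realType.
Implicit Types (a b c d : R) (z : R * R).

Lemma same_orbit_trans z1 z2 z3 :
  same_orbit z1 z2 -> same_orbit z2 z3 -> same_orbit z1 z3.
Proof.
move=> [e [m [n [eE z1E z2E]]]] [e' [m' [n' [eE' z1E' z2E']]]].
have [k kE] : exists k : int, e = k%:~R.
  by case: eE => ->; [exists 1|exists (-1)]; rewrite ?rmorphN1.
exists (e * e'), (m + k * m'), (n + k * n').
rewrite z1E z2E z1E' z2E' kE; split; [rewrite -kE|ring|ring].
by case: eE => ->; case: eE' => ->; [left|right|right|left]; ring.
Qed.

(** The net has ABC in the middle and the other faces unfolded around its sides. Charts agree along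
    a side of ABC; along AD, BD and CD they differ by the half-turn about A, B and C
    respectively. *)
Lemma chart_transition i j a b c d : a + b + c + d = 1 ->
  missing_weight i a b c d = 0 -> missing_weight j a b c d = 0 ->
  same_orbit (chart i a b c d) (chart j a b c d).
Proof.
have tr z z' (e : R) (m n : int) : e = 1 \/ e = -1 ->
    z.1 = e * z'.1 + 2 * m%:~R -> z.2 = e * z'.2 + 2 * n%:~R -> same_orbit z z'.
  by move=> ? ? ?; exists e, m, n.
have l : (1 : R) = 1 \/ (1 : R) = -1 by left.
have r : (-1 : R) = 1 \/ (-1 : R) = -1 by right.
move=> abcd; move: i j; rewrite /missing_weight /chart.
elim/ord4_cases; elim/ord4_cases; rewrite !inordK//= => i0 j0.
all: first [by apply: (tr _ _ 1 0 0) => //=; rewrite mulr0z; lra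
          | by apply: (tr _ _ (-1) 0 0) => //=; rewrite mulr0z; lra
          | by apply: (tr _ _ (-1) 1 0) => //=; rewrite ?mulr0z ?mulr1z; lra
          | by apply: (tr _ _ (-1) 0 1) => //=; rewrite ?mulr0z ?mulr1z; lra].
Qed.

Lemma int_ge1 (k : int) : k != 0 -> 1 <= (k%:~R : R) \/ (k%:~R : R) <= -1.
Proof.
move=> k0; have [h|h] := lerP 1 k; [left|right].
  by rewrite -[1]/(1%:~R) ler_int.
by rewrite -[-1]/((-1)%:~R) ler_int; lia.
Qed.

(* z0 is a point of the face ABC; the other point lies on the face ACD and has
   weights (b - a) / 3 at A and d at D. *)
Lemma orbit_far a b c z : 0 <= c -> c <= a -> a <= b -> a + b + c = 1 ->
  let d := 1 / 2 + 3 * c / 2 - (b - a) / 6 in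
  same_orbit z (- d, 1 - (b - a) / 3) ->
  1 <= (z.1 - b) ^+ 2 + (z.1 - b) * (z.2 - c) + (z.2 - c) ^+ 2.
Proof.
move=> c0 ca ab abc d [e [m [n [eE /= -> ->]]]].
have off (k : int) (t : R) : k != 0 -> -1 <= 3 * t <= 1 -> 1 <= 3 * (k%:~R - t) ^+ 2.
  by move=> /int_ge1[h|h] ht; nra.
have sq1 (k : int) : k != 0 -> 1 <= (k%:~R : R) ^+ 2.
  by move=> /int_ge1[h|h]; nra.
have aE : a = 1 - b - c by lra.
(* For either sign the squared distance splits as [3 X^2 + Y^2], and the choice of the point makes
   [Y] an integer. [X] is an integer minus [nu] or [mu], of size at most [1/3]: if that integer is 0
   then [Y] is odd, otherwise [|X| >= 2/3]. *)
case: eE => ->.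
  pose nu := (2 * b + 4 * c - 1) / 3.
  have nuP : -1 <= 3 * nu <= 1 by rewrite /nu; lra.
  rewrite (_ : (_ + _ + _) = 3 * ((m + n)%:~R - nu) ^+ 2 + ((m - n - 1)%:~R) ^+ 2).
    have [mn|mn] := eqVneq (m + n) 0.
      by have := sq1 (m - n - 1) ltac:(lia); have := sqr_ge0 ((m + n)%:~R - nu); lra.
    by have := off _ _ mn nuP; have := sqr_ge0 ((m - n - 1)%:~R : R); lra.
  by rewrite /nu /d aE !(intrD, rmorphB, rmorph1)/=; field.
pose mu := (2 * b - 2 * c - 1) / 3.
have muP : -1 <= 3 * mu <= 1 by rewrite /mu; lra.
rewrite (_ : (_ + _ + _) = 3 * (m%:~R - mu) ^+ 2 + ((n + n + m - 1)%:~R) ^+ 2).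
  have [m0|m0] := eqVneq m 0.
    by have := sq1 (n + n + m - 1) ltac:(lia); have := sqr_ge0 (m%:~R - mu); lra.
  by have := off _ _ m0 muP; have := sqr_ge0 ((n + n + m - 1)%:~R : R); lra.
by rewrite /mu /d aE !(intrD, rmorphB, rmorph1)/=; field.
Qed.

End Unfolding.

(** * Distances on a regular tetrahedron *)

Section Regular.
Variables (R : realType) (n : nat) (A B C D : 'rV[R]_n) (l : R).
Hypothesis l0 : 0 < l.
Hypotheses (AB : enorm (A - B) = l) (AC : enorm (A - C) = l)
  (AD : enorm (A - D) = l) (BC : enorm (B - C) = l) (BD : enorm (B - D) = l)
  (CD : enorm (C - D) = l).
Implicit Types (a b c d : R) (z : R * R) (x y p q : 'rV[R]_n).

Let comb a b c d := a *: A + b *: B + c *: C + d *: D.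
Let plane z := z.1 *: (B - A) + z.2 *: (C - A).

Lemma sqr_enorm_comb a b c d : a + b + c + d = 0 ->
  enorm (comb a b c d) ^+ 2 =
  - (a * b + a * c + a * d + b * c + b * d + c * d) * l ^+ 2.
Proof. by move=> h; rewrite sqr_enorm_bary// AB AC AD BC BD CD; ring. Qed.

Lemma sqr_enorm_plane z :
  enorm (plane z) ^+ 2 = (z.1 ^+ 2 + z.1 * z.2 + z.2 ^+ 2) * l ^+ 2.
Proof.
have -> : plane z = comb (- z.1 - z.2) z.1 z.2 0.
  by apply/rowP => i; rewrite /plane /comb !mxE; ring.
by rewrite sqr_enorm_comb; ring.
Qed.

(** On weights of sum 0 the quadratic form of [sqr_enorm_comb] is [l^2 / 2] times the sum of their
    squares, hence positive definite. *)
Lemma comb_inj a b c d a' b' c' d' :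
  a + b + c + d = 1 -> a' + b' + c' + d' = 1 ->
  comb a b c d = comb a' b' c' d' -> [/\ a = a', b = b', c = c' & d = d'].
Proof.
move=> h h' e.
have : enorm (comb (a - a') (b - b') (c - c') (d - d')) ^+ 2 = 0.
  rewrite (_ : comb _ _ _ _ = comb a b c d - comb a' b' c' d').
    by rewrite e subrr enorm0 expr0n.
  by apply/rowP => i; rewrite /comb !mxE; ring.
rewrite sqr_enorm_comb; last by lra.
move=> /eqP; rewrite mulf_eq0 sqrf_eq0 (gt_eqF l0) orbF => /eqP sq0.
have : (a - a') ^+ 2 + (b - b') ^+ 2 + (c - c') ^+ 2 + (d - d') ^+ 2 = 0.
  have sum0 : a - a' + (b - b') + (c - c') + (d - d') = 0 by lra.
  have := congr1 (fun t => t ^+ 2) sum0.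
  by rewrite /= expr0n/=; lra.
have := sqr_ge0 (a - a'); have := sqr_ge0 (b - b').
have := sqr_ge0 (c - c'); have := sqr_ge0 (d - d').
move=> ? ? ? ? ?.
by split; apply/eqP; rewrite -subr_eq0 -sqrf_eq0; apply/eqP; lra.
Qed.

Let F (i : 'I_4) : set 'rV[R]_n :=
  nth set0 [:: triangle A B C; triangle B C D; triangle A C D; triangle A B D] i.

Lemma face_weights i p : F i p -> exists a b c d,
  [/\ a + b + c + d = 1, missing_weight i a b c d = 0 & p = comb a b c d].
Proof.
move: i; rewrite /F /missing_weight /comb; elim/ord4_cases; rewrite inordK//=.
- move=> [a [b [c [_ _ _ h ->]]]]; exists a, b, c, 0.
  by split; [lra| |apply/rowP => i; rewrite !mxE; ring].
- move=> [a [b [c [_ _ _ h ->]]]]; exists 0, a, b, c.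
  by split; [lra| |apply/rowP => i; rewrite !mxE; ring].
- move=> [a [b [c [_ _ _ h ->]]]]; exists a, 0, b, c.
  by split; [lra| |apply/rowP => i; rewrite !mxE; ring].
- move=> [a [b [c [_ _ _ h ->]]]]; exists a, b, 0, c.
  by split; [lra| |apply/rowP => i; rewrite !mxE; ring].
Qed.

(** Weights of sum 0 are differences of points, and charts are linear in the weights: a chord inside
    a face keeps its length when unfolded. *)
Lemma chart_isometry i a b c d : a + b + c + d = 0 ->
  missing_weight i a b c d = 0 ->
  enorm (plane (chart i a b c d)) = enorm (comb a b c d).
Proof.
move=> h i0; apply/eqP; rewrite -(@eqrXn2 _ 2) ?enorm_ge0//; apply/eqP.
rewrite sqr_enorm_plane sqr_enorm_comb//; congr (_ * _).
have aE : a = - (b + c + d) by lra.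
move: i i0; rewrite /missing_weight /chart; elim/ord4_cases; rewrite inordK//= => i0.
- by rewrite aE i0; ring.
- by rewrite i0 (_ : b = - c - d); [ring|lra].
- by rewrite aE i0; ring.
- by rewrite aE i0; ring.
Qed.

Lemma chartB i a b c d a' b' c' d' :
  chart i (a - a') (b - b') (c - c') (d - d') =
  ((chart i a b c d).1 - (chart i a' b' c' d').1,
   (chart i a b c d).2 - (chart i a' b' c' d').2).
Proof.
by move: i; rewrite /chart; elim/ord4_cases; rewrite inordK//=; congr (_, _); ring.
Qed.

Lemma missing_weightB i a b c d a' b' c' d' :
  missing_weight i (a - a') (b - b') (c - c') (d - d') =
  missing_weight i a b c d - missing_weight i a' b' c' d'.
Proof. by move: i; rewrite /missing_weight; elim/ord4_cases; rewrite inordK. Qed.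

(** The invariant [P p r] says that some planar image of [p] is within [r] of [(b, c)], the image of
    the starting point. A chord inside a face moves the image by its own length, and [orbit_far]
    keeps every image of the chosen point at distance at least [l]. *)
Lemma regular_dist_ge S a b c :
  S `<=` \bigcup_i F i -> 0 <= c -> c <= a -> a <= b -> a + b + c = 1 ->
  exists2 y, triangle A C D y &
    (l%:E <= intrinsic_dist S (a *: A + b *: B + c *: C) y)%E.
Proof.
move=> SF c0 ca ab abc.
pose wD := 1 / 2 + 3 * c / 2 - (b - a) / 6; pose wA := (b - a) / 3.
pose wC := 1 - wA - wD.
exists (wA *: A + wC *: C + wD *: D).
  by exists wA, wC, wD; split=> //; rewrite /wC /wD /wA; lra.
pose P p r := exists a' b' c' d' i z, [/\ a' + b' + c' + d' = 1,
  p = comb a' b' c' d', missing_weight i a' b' c' d' = 0,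
  same_orbit z (chart i a' b' c' d') & enorm (plane (z.1 - b, z.2 - c)) <= r].
apply: (@path_chain R n S _ F P) => //.
- rewrite /F; elim/ord4_cases; rewrite inordK//=; exact: closed_triangle.
- move=> i p q r Fp Fq [a1 [b1 [c1 [d1 [j [z [h1 pE j0 zE zr]]]]]]].
  have [a2 [b2 [c2 [d2 [h2 i0 qE]]]]] := face_weights Fq.
  have i01 : missing_weight i a1 b1 c1 d1 = 0.
    have [a3 [b3 [c3 [d3 [h3 i3]]]]] := face_weights Fp.
    by rewrite pE => /(comb_inj h1 h3)[-> -> -> ->].
  (* The image [z] of [p] is read again in the chart of face [i]; the same group element applied to
     the chart of [q] gives the new image. *)
  have [e [m [k [eE z1E z2E]]]] := same_orbit_trans zE (chart_transition h1 j0 i01).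
  pose u := chart i a2 b2 c2 d2.
  exists a2, b2, c2, d2, i, (e * u.1 + 2 * m%:~R, e * u.2 + 2 * k%:~R).
  split=> //; first by exists e, m, k.
  have -> : plane (e * u.1 + 2 * m%:~R - b, e * u.2 + 2 * k%:~R - c) =
      plane (z.1 - b, z.2 - c) +
      e *: plane (chart i (a2 - a1) (b2 - b1) (c2 - c1) (d2 - d1)).
    by rewrite chartB -/u z1E z2E; apply/rowP => h; rewrite /plane !mxE/=; ring.
  apply: le_trans (enormD _ _) (lerD zr _); rewrite enormZ chart_isometry.
  + rewrite (_ : `|e| = 1) ?mul1r; last by case: eE => ->; rewrite ?normrN1 ?normr1.
    rewrite qE pE le_eqVlt (_ : comb _ _ _ _ = comb a2 b2 c2 d2 - comb a1 b1 c1 d1) ?eqxx//.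
    by apply/rowP => h; rewrite /comb !mxE; ring.
  + by lra.
  + by rewrite missing_weightB i0 i01 subrr.
- exists a, b, c, 0, (inord 0), (b, c); split=> //.
  + by lra.
  + by rewrite /comb scale0r addr0.
  + by rewrite /missing_weight inordK.
  + exists 1, 0, 0; rewrite /chart inordK//=.
    by split; [left|rewrite mulr0z; ring|rewrite mulr0z; ring].
  + by rewrite !subrr /plane/= !scale0r addr0 enorm0.
- move=> r [a1 [b1 [c1 [d1 [j [z [h1 yE j0 zE zr]]]]]]]; apply: le_trans zr.
  have [a1E b1E c1E d1E] : [/\ wA = a1, 0 = b1, wC = c1 & wD = d1].
    apply: comb_inj => //; first by rewrite /wC; ring.
    by rewrite -yE /comb scale0r addr0.
  (* The target has no weight at B, so its images can be read in the chart of ACD, as [orbit_far]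
     expects. *)
  have j2 : missing_weight (inord 2) a1 b1 c1 d1 = 0.
    by rewrite /missing_weight inordK//= -b1E.
  have := same_orbit_trans zE (chart_transition h1 j0 j2).
  rewrite /chart inordK//= -c1E -d1E (_ : wC + wD = 1 - (b - a) / 3); last first.
    by rewrite /wC /wA; ring.
  move=> /(orbit_far c0 ca ab abc) far.
  rewrite -(@ler_pXn2r _ 2) ?nnegrE ?enorm_ge0 ?(ltW l0)// sqr_enorm_plane/=.
  by rewrite ler_peMl// sqr_ge0.
Qed.

End Regular.

(** * Labelled vertices and faces of the tetrahedron *)

Lemma ord4_mem (i j k l : 'I_4) : uniq [:: i; j; k; l] ->
  forall h, h \in [:: i; j; k; l].
Proof.
move=> u h; have [||_ ->] := @uniq_min_size _ [:: i; j; k; l] (enum 'I_4) u.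
- by move=> x _; rewrite mem_enum.
- by rewrite size_enum_ord.
- by rewrite mem_enum.
Qed.

Lemma ord4_complete (i j : 'I_4) : i != j -> exists k l, uniq [:: i; j; k; l].
Proof.
move=> ij; have /cards2P[k [l [kl kE]]] : #|~: [set i; j]| == 2.
  by rewrite cardsCs finset.setCK cards2 ij card_ord.
have : k \in ~: [set i; j] by rewrite kE !inE eqxx.
have : l \in ~: [set i; j] by rewrite kE !inE eqxx orbT.
rewrite !inE !negb_or => /andP[li lj] /andP[ki kj]; exists k, l.
by rewrite /= !inE !negb_or ij kl (eq_sym i k) (eq_sym i l) (eq_sym j k) (eq_sym j l) ki kj li lj.
Qed.

Lemma big_ord4 (V : nmodType) (f : 'I_4 -> V) (i j k l : 'I_4) :
  uniq [:: i; j; k; l] -> \sum_(h < 4) f h = f i + f j + f k + f l.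
Proof.
move=> u; rewrite (perm_big [:: i; j; k; l])/=; last first.
  apply: uniq_perm => // [|h]; first exact: index_enum_uniq.
  by rewrite mem_index_enum ord4_mem.
by rewrite !big_cons big_nil addr0 !addrA.
Qed.

Section Vertices.
Variables (R : realType) (v : 'I_4 -> 'rV[R]_3).
Implicit Types (i j k l : 'I_4).

Lemma face_triangle i j k l : uniq [:: i; j; k; l] ->
  face v i = triangle (v j) (v k) (v l).
Proof.
move=> u; have := u; rewrite /= !inE !negb_or => /and4P[/and3P[ij ik il] /andP[jk jl] kl _].
rewrite eqEsubset; split=> [_ [w [w0 w1 wi] <-]|_ [a [b [c [a0 b0 c0 abc ->]]]]].
  exists (w j), (w k), (w l); split=> //.
    by rewrite -w1 (big_ord4 _ u) wi add0r.
  by rewrite (big_ord4 _ u) wi scale0r add0r.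
pose w h : R := if h == j then a else if h == k then b else if h == l then c else 0.
have [wi wj wk wl] : [/\ w i = 0, w j = a, w k = b & w l = c].
  rewrite /w !eqxx (negbTE ij) (negbTE ik) (negbTE il).
  by rewrite (eq_sym k j) (eq_sym l j) (eq_sym l k) (negbTE jk) (negbTE jl) (negbTE kl).
exists w; last by rewrite (big_ord4 _ u) wi wj wk wl scale0r add0r.
split=> //; last by rewrite (big_ord4 _ u) wi wj wk wl add0r.
by move=> h; rewrite /w; do 3 case: ifP => // _.
Qed.

Lemma tetrahedron_triangles i j k l : uniq [:: i; j; k; l] ->
  tetrahedron v = triangle (v i) (v j) (v k) `|` triangle (v i) (v j) (v l)
    `|` triangle (v i) (v k) (v l) `|` triangle (v j) (v k) (v l).
Proof.
move=> u.
have ul : uniq [:: l; i; j; k] by rewrite (uniq_catCA [:: l] [:: i; j; k] [::]).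
have uk : uniq [:: k; i; j; l] by rewrite (uniq_catCA [:: k] [:: i; j] [:: l]).
have uj : uniq [:: j; i; k; l] by rewrite (uniq_catCA [:: j] [:: i] [:: k; l]).
rewrite -(face_triangle ul) -(face_triangle uk) -(face_triangle uj) -(face_triangle u).
rewrite eqEsubset; split=> [x [h _]|x].
  have := ord4_mem u h; rewrite !inE => /or4P[] /eqP -> xh.
  - by right.
  - by left; right.
  - by left; left; right.
  - by left; left; left.
by case=> [[[]|]|]; [exists l|exists k|exists j|exists i].
Qed.

Lemma affine_independent_inj : affine_independent v -> injective v.
Proof.
rewrite /affine_independent; set M := \matrix_i _; move=> /row_free_inj Minj.
have rowM h : delta_mx ord0 h *m M = v (lift ord0 h) - v ord0.
  by rewrite -rowE rowK.
have neq0 h : v (lift ord0 h) <> v ord0.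
  move=> e; have e0 : (delta_mx ord0 h : 'rV[R]_3) = 0.
    by apply: Minj; rewrite rowM e subrr mul0mx.
  have /rowP/(_ h)/eqP := e0.
  by rewrite !mxE !eqxx/= oner_eq0.
move=> i j; case: (unliftP ord0 i) => [i' ->|->]; case: (unliftP ord0 j) => [j' ->|->] //.
- move=> e; have e0 : (delta_mx ord0 i' : 'rV[R]_3) = delta_mx ord0 j'.
    by apply: Minj; rewrite !rowM e.
  have /rowP/(_ i')/eqP := e0.
  by have [->//|ne] := eqVneq i' j'; rewrite !mxE !eqxx (negbTE ne) oner_eq0.
- by move=> /neq0.
- by move=> /esym/neq0.
Qed.

Lemma exists_longest_edge : exists i j k l, uniq [:: i; j; k; l] /\
  forall p q, enorm (v p - v q) <= enorm (v i - v j).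
Proof.
pose F (p : 'I_4 * 'I_4) := enorm (v p.1 - v p.2).
have [[i j] /= ij max] := @arg_maxP _ _ _ (ord0 : 'I_4, ord_max : 'I_4)
  (fun p => p.1 != p.2) F isT.
have [k [l u]] := ord4_complete ij; exists i, j, k, l; split=> // p q.
have [->|pq] := eqVneq p q; last exact: (max (p, q)).
by rewrite subrr enorm0 enorm_ge0.
Qed.

(** Convexity of the distance, used in each of its two arguments, brings the maximum to a pair of
    vertices. *)
Lemma diam_tetrahedron (i j k l : 'I_4) : uniq [:: i; j; k; l] ->
  (forall p q, enorm (v p - v q) <= enorm (v i - v j)) ->
  diam (tetrahedron v) = (enorm (v i - v j))%:E.
Proof.
move=> u max; have TE := tetrahedron_triangles u.
have vT h y r : tetrahedron v y -> (forall p, enorm (v p - h) <= r) -> enorm (y - h) <= r.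
  rewrite TE => yT hr.
  by case: yT => [[[]|]|] /enorm_triangle_le; apply; exact: hr.
apply/eqP; rewrite eq_le; apply/andP; split.
  apply: ge_ereal_sup => _ [x xT [y yT <-]]; rewrite lee_fin.
  apply: (vT) => // p; rewrite enormB; apply: vT => // q; exact: max.
apply: ereal_sup_ubound; exists (v i).
  rewrite TE; left; left; left; exists 1, 0, 0; split=> //; first by rewrite !addr0.
  by rewrite scale1r !scale0r !addr0.
exists (v j) => //.
rewrite TE; left; left; left; exists 0, 1, 0; split=> //; first by rewrite add0r addr0.
by rewrite scale1r !scale0r add0r addr0.
Qed.

Lemma regular_far_point (r : R) x : 0 < r ->
  (forall i j, i != j -> enorm (v i - v j) = r) -> tetrahedron v x ->
  exists2 y, tetrahedron v y & (r%:E <= intrinsic_dist (tetrahedron v) x y)%E.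
Proof.
move=> r0 reg [l _ xl].
have [i [j [k u]]] : exists i j k, uniq [:: i; j; k; l].
  have /ord4_complete[i [j]] : l != lift l ord0 by rewrite neq_lift.
  move=> u; exists (lift l ord0), i, j.
  by rewrite (uniq_catCA [:: _; i; j] [:: l] [::]).
have ul : uniq [:: l; i; j; k] by rewrite (uniq_catCA [:: l] [:: i; j; k] [::]).
(* The vertices of the face containing [x] are renamed so that [c <= a <= b]; [l] stays the vertex
   off that face. *)
have ordered i' j' k' (a b c : R) : uniq [:: i'; j'; k'; l] ->
    0 <= c -> c <= a -> a <= b -> a + b + c = 1 ->
    x = a *: v i' + b *: v j' + c *: v k' ->
    exists2 y, tetrahedron v y & (r%:E <= intrinsic_dist (tetrahedron v) x y)%E.
  move=> u' c0 ca ab abc ->; have TE := tetrahedron_triangles u'.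
  have := u'; rewrite /= !inE !negb_or => /and4P[/and3P[ij ik il] /andP[jk jl] kl _].
  have [|y yF yr] := regular_dist_ge r0 (reg _ _ ij) (reg _ _ ik) (reg _ _ il)
    (reg _ _ jk) (reg _ _ jl) (reg _ _ kl) (S := tetrahedron v) _ c0 ca ab abc.
    rewrite TE => y [[[]|]|] yF;
    [exists (inord 0)|exists (inord 3)|exists (inord 2)|exists (inord 1)] => //;
    by rewrite inordK.
  by exists y => //; rewrite TE; left; right.
move: xl; rewrite (face_triangle ul) => -[a [b [c [a0 b0 c0 abc xE]]]].
have uji : uniq [:: j; i; k; l] by rewrite (uniq_catCA [:: j] [:: i] [:: k; l]).
have uki : uniq [:: k; i; j; l] by rewrite (uniq_catCA [:: k] [:: i; j] [:: l]).
have ujk : uniq [:: j; k; i; l] by rewrite (uniq_catCA [:: j; k] [:: i] [:: l]).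
have uik : uniq [:: i; k; j; l] by rewrite (uniq_catCA [:: i] [:: k] [:: j; l]).
have ukj : uniq [:: k; j; i; l] by rewrite (uniq_catCA [:: k; j] [:: i] [:: l]).
have [ab|/ltW ab] := leP a b; have [bc|/ltW bc] := leP b c;
  have [ac|/ltW ac] := leP a c.
- by apply: (ordered j k i b c a) => //; [lra|rewrite xE; apply/rowP => h; rewrite !mxE; ring].
- by apply: (ordered j k i b c a) => //; [lra|rewrite xE; apply/rowP => h; rewrite !mxE; ring].
- by apply: (ordered k j i c b a) => //; [lra|rewrite xE; apply/rowP => h; rewrite !mxE; ring].
- by apply: (ordered i j k a b c) => //.
- by apply: (ordered i k j a c b) => //; [lra|rewrite xE; apply/rowP => h; rewrite !mxE; ring].
- by apply: (ordered k i j c a b) => //; [lra|rewrite xE; apply/rowP => h; rewrite !mxE; ring].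
- by apply: (ordered j i k b a c) => //; [lra|rewrite xE; apply/rowP => h; rewrite !mxE; ring].
- by apply: (ordered j i k b a c) => //; [lra|rewrite xE; apply/rowP => h; rewrite !mxE; ring].
Qed.

End Vertices.

(** * Comparison of radius and diameter *)

Local Open Scope ring_scope.
Local Open Scope ereal_scope.

Theorem theorem2 (R : realType) (v : 'I_4 -> 'rV[R]_3)
    (hv : affine_independent v) :
  Rad (tetrahedron v) <= diam (tetrahedron v) /\
  (Rad (tetrahedron v) = diam (tetrahedron v) <-> regular_tetrahedron v).
Proof.
have [i [j [k [l [u max]]]]] := exists_longest_edge v.
have := u; rewrite /= !inE !negb_or => /and4P[/and3P[ij _ _] _ kl _].
have pos p q : p != q -> (0 < enorm (v p - v q))%R.
  move=> pq; rewrite lt_neqAle enorm_ge0 andbT eq_sym; apply/eqP.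
  by move=> /enorm0_eq0/eqP; rewrite subr_eq0 (inj_eq (affine_independent_inj hv)) (negbTE pq).
rewrite (diam_tetrahedron u max).
have [Rad_le_edge Rad_lt_edge] := Rad_le_longest_edge (tetrahedron_triangles v u)
  erefl (max _ _) (max _ _) (max _ _) (max _ _) (max _ _) (pos _ _ kl).
split=> //; split=> [RadE|reg].
  have [[ik il jk jl kl']|nreg] := pselect [/\ enorm (v i - v k) = enorm (v i - v j),
      enorm (v i - v l) = enorm (v i - v j), enorm (v j - v k) = enorm (v i - v j),
      enorm (v j - v l) = enorm (v i - v j) &
      enorm (v k - v l) = enorm (v i - v j)]; last first.
    by have := Rad_lt_edge nreg; rewrite RadE ltxx.
  have edge p q : p != q -> enorm (v p - v q) = enorm (v i - v j).
    have := ord4_mem u p; have := ord4_mem u q; rewrite !inE.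
    by move=> /or4P[] /eqP -> /or4P[] /eqP ->; rewrite ?eqxx// => _;
      rewrite 1?enormB.
  by move=> p q p' q' pq pq'; rewrite !edge.
(* In the regular case every point has another at distance at least the edge length, so the infimum
   is no smaller. *)
apply/eqP; rewrite eq_le Rad_le_edge/=.
apply: le_ereal_inf_tmp => _ [x xT <-].
have [y yT xy] := regular_far_point (pos _ _ ij) (fun p q pq => reg p q i j pq ij) xT.
by apply: (le_trans xy); apply: ereal_sup_ubound; exists y.
Qed.
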